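(* Let $(A,\circ,\alpha)$ be a Hom-Jordan algebra and $(V,\rho,\phi)$ a representation of it. Let $T:V\to A$ be an $\mathcal{O}$-operator of $A$ associated to $\rho$. Then: 1. $(V,\ast,\phi)$ is a Hom-pre-Jordan algebra, where $u\ast v=\rho(T(u))v$ for all $u,v\in V$. 2. Therefore there is an associated Hom-Jordan algebra structure on $V$ (with twist map $\phi$) given by the product $u\ast v+v\ast u$, and $T$ is a homomorphism of Hom-Jordan algebras from it to $(A,\circ,\alpha)$. 3. $T(V)=\{T(v)\mid v\in V\}\subset A$ is a Hom-Jordan subalgebra of $(A,\circ,\alpha)$, and there is an induced Hom-pre-Jordan algebra structure on $T(V)$ given by $T(u)\cdot T(v)=T(u\ast v)$ for all $u,v\in V$. 4. The Hom-Jordan algebra structure on $T(V)$ associated to this Hom-pre-Jordan structure (product $a\cdot b+b\cdot a$) is just a Hom-Jordan subalgebra of $(A,\circ,\alpha)$, and $T$ is a homomorphism of Hom-pre-Jordan algebras from $V$ to $T(V)$.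
   Context: All vector spaces are over a field $\mathbb{K}$ of characteristic $0$. A Hom-algebra is a triple $(A,\mu,\alpha)$ with $A$ a vector space, $\mu$ a bilinear multiplication on $A$, and $\alpha:A\to A$ a linear map. A Hom-Jordan algebra is a Hom-algebra $(A,\circ,\alpha)$ such that, for all $x,y\in A$, $x\circ y=y\circ x$ and $as_\alpha(x\circ x,\alpha(y),\alpha(x))=0$, where $as_\alpha(a,b,c)=(a\circ b)\circ\alpha(c)-\alpha(a)\circ(b\circ c)$. A Hom-pre-Jordan algebra is a Hom-algebra $(A,\cdot,\alpha)$ such that, writing $x\circ y=x\cdot y+y\cdot x$, for all $x,y,z,u\in A$: $$[\alpha(x)\circ\alpha(y)]\cdot[\alpha(z)\cdot\alpha(u)]+[\alpha(y)\circ\alpha(z)]\cdot[\alpha(x)\cdot\alpha(u)]+[\alpha(z)\circ\alpha(x)]\cdot[\alpha(y)\cdot\alpha(u)]$$ $$=\alpha^2(x)\cdot[(y\circ z)\cdot\alpha(u)]+\alpha^2(y)\cdot[(z\circ x)\cdot\alpha(u)]+\alpha^2(z)\cdot[(x\circ y)\cdot\alpha(u)],$$ and $$[(x\circ z)\circ\alpha(y)]\cdot\alpha^2(u)+\alpha^2(x)\cdot[\alpha(y)\cdot(z\cdot u)]+\alpha^2(z)\cdot[\alpha(y)\cdot(x\cdot u)]$$ $$=\alpha^2(x)\cdot[(y\circ z)\cdot\alpha(u)]+\alpha^2(y)\cdot[(z\circ x)\cdot\alpha(u)]+\alpha^2(z)\cdot[(x\circ y)\cdot\alpha(u)].$$ A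 representation of a Hom-Jordan algebra $(A,\circ,\alpha)$ is a triple $(V,\rho,\phi)$ with $V$ a vector space, $\rho:A\to gl(V)$ linear ($gl(V)$ the linear endomorphisms of $V$) and $\phi:V\to V$ linear, such that for all $x,y,z\in A$: $$\phi\,\rho(x)=\rho(\alpha(x))\,\phi,$$ $$\rho(\alpha^2(x))\rho(y\circ z)\phi+\rho(\alpha^2(y))\rho(z\circ x)\phi+\rho(\alpha^2(z))\rho(x\circ y)\phi$$ $$=\rho(\alpha(x)\circ\alpha(y))\rho(\alpha(z))\phi+\rho(\alpha(y)\circ\alpha(z))\rho(\alpha(x))\phi+\rho(\alpha(z)\circ\alpha(x))\rho(\alpha(y))\phi,$$ $$\rho((x\circ y)\circ\alpha(z))\phi^2+\rho(\alpha^2(x))\rho(\alpha(z))\rho(y)+\rho(\alpha^2(y))\rho(\alpha(z))\rho(x)$$ $$=\rho(\alpha(x)\circ\alpha(y))\rho(\alpha(z))\phi+\rho(\alpha(y)\circ\alpha(z))\rho(\alpha(x))\phi+\rho(\alpha(z)\circ\alpha(x))\rho(\alpha(y))\phi.$$ A linear map $T:V\to A$ is an $\mathcal{O}$-operator of $(A,\circ,\alpha)$ associated to $\rho$ if $T\phi=\alpha T$ and $T(u)\circ T(v)=T\big(\rho(T(u))v+\rho(T(v))u\big)$ for all $u,v\in V$. Homomorphisms of Hom-algebras are linear maps preserving products and commuting with the twist maps; subalgebras are subspaces closed under the product and the twist map. *)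

(* Defs.v *)
From HB Require Import structures.
From mathcomp Require Import all_boot all_order all_algebra.
From mathcomp Require Import boolp classical_sets.

Set Implicit Arguments.
Unset Strict Implicit.
Unset Printing Implicit Defensive.

Import GRing.Theory.

Local Open Scope classical_set_scope.
Local Open Scope ring_scope.

(* A Hom-algebra (A, mu, alpha) is given unbundled: a K-vector space A (of
   arbitrary dimension, an lmodType K), a bilinear mu and a linear alpha. *)

Section HomAlgebras.
Variables (K : fieldType) (A : lmodType K).
Implicit Types (mu : {bilinear A -> A -> A}) (alpha : {linear A -> A}).

Definition hom_associator mu alpha (a b c : A) : A :=
  mu (mu a b) (alpha c) - mu (alpha a) (mu b c).

Definition hom_Jordan mu alpha : Prop :=
  (forall x y, mu x y = mu y x) /\
  (forall x y, hom_associator mu alpha (mu x x) (alpha y) (alpha x) = 0).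

Definition anticommutator mu (x y : A) : A := mu x y + mu y x.

Lemma anticommutator_is_bilinear mu :
  bilinear_for *:%R *:%R (anticommutator mu).
Proof.
split=> z a x y; rewrite /anticommutator.
  by rewrite linearPl linearPr /= scalerDr addrACA.
by rewrite linearPr linearPl /= scalerDr addrACA.
Qed.

HB.instance Definition _ mu :=
  bilinear_isBilinear.Build K A A A *:%R *:%R (anticommutator mu)
    (anticommutator_is_bilinear mu).

Definition hom_pre_Jordan mu alpha : Prop :=
  let dot := mu in
  let circ := anticommutator mu in
  let alpha2 x := alpha (alpha x) in
  (forall x y z u,
     dot (circ (alpha x) (alpha y)) (dot (alpha z) (alpha u))
     + dot (circ (alpha y) (alpha z)) (dot (alpha x) (alpha u))
     + dot (circ (alpha z) (alpha x)) (dot (alpha y) (alpha u))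
     = dot (alpha2 x) (dot (circ y z) (alpha u))
       + dot (alpha2 y) (dot (circ z x) (alpha u))
       + dot (alpha2 z) (dot (circ x y) (alpha u))) /\
  (forall x y z u,
     dot (circ (circ x z) (alpha y)) (alpha2 u)
     + dot (alpha2 x) (dot (alpha y) (dot z u))
     + dot (alpha2 z) (dot (alpha y) (dot x u))
     = dot (alpha2 x) (dot (circ y z) (alpha u))
       + dot (alpha2 y) (dot (circ z x) (alpha u))
       + dot (alpha2 z) (dot (circ x y) (alpha u))).

Definition hom_subalgebra mu alpha (S : set A) : Prop :=
  [/\ submod_closed (mem S),
      forall x y, S x -> S y -> S (mu x y)
    & forall x, S x -> S (alpha x)].

End HomAlgebras.

Definition hom_morphism (K : fieldType) (A B : lmodType K)
    (mu : {bilinear A -> A -> A}) (alpha : {linear A -> A})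
    (nu : {bilinear B -> B -> B}) (beta : {linear B -> B})
    (f : {linear A -> B}) : Prop :=
  (forall x y, f (mu x y) = nu (f x) (f y)) /\
  (forall x, f (alpha x) = beta (f x)).

Section Representations.
Variables (K : fieldType) (A V : lmodType K).
Variables (mu : {bilinear A -> A -> A}) (alpha : {linear A -> A}).
(* A linear map rho : A -> gl(V) is given in uncurried form, as the bilinear
   map (x, v) |-> rho(x)v; identities between endomorphisms of V are stated
   pointwise. *)
Variables (rho : {bilinear A -> V -> V}) (phi : {linear V -> V}).

Definition hom_Jordan_representation : Prop :=
  let alpha2 x := alpha (alpha x) in
  [/\ forall x v, phi (rho x v) = rho (alpha x) (phi v),
      forall x y z v,
        rho (alpha2 x) (rho (mu y z) (phi v))
        + rho (alpha2 y) (rho (mu z x) (phi v))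
        + rho (alpha2 z) (rho (mu x y) (phi v))
        = rho (mu (alpha x) (alpha y)) (rho (alpha z) (phi v))
          + rho (mu (alpha y) (alpha z)) (rho (alpha x) (phi v))
          + rho (mu (alpha z) (alpha x)) (rho (alpha y) (phi v))
    & forall x y z v,
        rho (mu (mu x y) (alpha z)) (phi (phi v))
        + rho (alpha2 x) (rho (alpha z) (rho y v))
        + rho (alpha2 y) (rho (alpha z) (rho x v))
        = rho (mu (alpha x) (alpha y)) (rho (alpha z) (phi v))
          + rho (mu (alpha y) (alpha z)) (rho (alpha x) (phi v))
          + rho (mu (alpha z) (alpha x)) (rho (alpha y) (phi v))].

Definition O_operator (T : {linear V -> A}) : Prop :=
  (forall v, T (phi v) = alpha (T v)) /\
  (forall u v, mu (T u) (T v) = T (rho (T u) v + rho (T v) u)).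

End Representations.

Section OperatorProduct.
Variables (K : fieldType) (A V : lmodType K).
Variables (rho : {bilinear A -> V -> V}) (T : {linear V -> A}).

Definition O_product (u v : V) : V := rho (T u) v.

Lemma O_product_is_bilinear : bilinear_for *:%R *:%R O_product.
Proof.
split=> z a x y; rewrite /O_product; last by rewrite linearPr.
by rewrite linearP linearPl.
Qed.

HB.instance Definition _ :=
  bilinear_isBilinear.Build K V V V *:%R *:%R O_product O_product_is_bilinear.

End OperatorProduct.

(* The image T(V) as a vector space in its own right, whose inclusion into A
   is the linear map val. *)
Section LinearImage.
Variables (K : fieldType) (A V : lmodType K) (T : {linear V -> A}).

Lemma range_submod_closed : submod_closed (mem (range T)).
Proof.
split=> [|a x y].
  by apply/mem_set; exists 0 => //; exact: linear0.
move=> /set_mem[u _ <-] /set_mem[v _ <-].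
by apply/mem_set; exists (a *: u + v) => //; exact: linearP.
Qed.

Definition linear_image : Type := {a : A | a \in range T}.

HB.instance Definition _ := SubChoice.on linear_image.
HB.instance Definition _ :=
  GRing.SubChoice_isSubLmodule.Build K A _ linear_image range_submod_closed.

Definition to_image (v : V) : linear_image := Sub (T v) (mem_range T v).

Lemma to_image_is_linear : linear to_image.
Proof. by move=> a u v; apply: val_inj; rewrite linearP !SubK linearP. Qed.

HB.instance Definition _ :=
  GRing.isLinear.Build K V linear_image *:%R to_image to_image_is_linear.

End LinearImage.

(* Main.v *)
Require Import Defs.
From HB Require Import structures.
From mathcomp Require Import all_boot all_order all_algebra.
From mathcomp Require Import boolp classical_sets.

(** The representation axioms evaluated at points of [T(V)] are the
    Hom-pre-Jordan axioms of [u * v = rho (T u) v]: the O-operator equation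
    says that [T] carries the anticommutator of [*] to [mu], so the products
    [mu (T u) (T v)] under [rho] become anticommutators, and commutativity of
    [mu] puts the summands in the required order.

    A Hom-pre-Jordan algebra whose twist map is multiplicative has a Hom-Jordan
    anticommutator as soon as 3 is invertible ([hom_Jordan_anticommutator]).
    Multiplicativity matters, because the Hom-Jordan identity contains
    [alpha (x o x)] whereas the Hom-pre-Jordan ones only contain
    [alpha x o alpha x].  For [*] it is the equivariance
    [phi (rho x v) = rho (alpha x) (phi v)], even when [alpha] is not
    multiplicative on all of [A].

    The kernel of [T] is a two-sided ideal for [*]: if [T u = 0], then
    [u * v = rho 0 v = 0], and [T (v * u) = mu (T v) 0 = 0] by the O-operator
    equation.  It is stable under [phi] because [T phi = alpha T].  Hence both
    [*] and [phi] descend to the image ([linear_descent],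
    [bilinear_descent]), and all identities are inherited along
    the surjection from [V] onto [T(V)]. *)

Set Implicit Arguments.
Unset Strict Implicit.
Unset Printing Implicit Defensive.

Import GRing.Theory.

Local Open Scope classical_set_scope.
Local Open Scope ring_scope.

(** * The Hom-Jordan algebra of a Hom-pre-Jordan algebra *)

(** In the expansion of the Hom-associator of [x o x], [alpha y], [alpha x],
    the two axioms at [(x, y, x, x)] have the same right-hand side, and
    comparing them leaves the difference of
    [alpha^2 x . ((x o x) . alpha y)] and
    [(alpha x o alpha x) . (alpha x . alpha y)].  The first axiom at
    [(x, x, x, y)] states that three times this difference vanishes, which is
    where 3 has to be cancelled. *)
Lemma hom_Jordan_anticommutator (K : fieldType) (A : lmodType K)
    (mu : {bilinear A -> A -> A}) (alpha : {linear A -> A}) :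
  3%:R != 0 :> K ->
  {morph alpha : x y / mu x y} ->
  hom_pre_Jordan mu alpha -> hom_Jordan (anticommutator mu) alpha.
Proof.
move=> K3 alphaM [pre1 pre2].
have circC x y : anticommutator mu x y = anticommutator mu y x.
  by rewrite /anticommutator addrC.
split=> // x y.
have alpha_circ a b :
    alpha (anticommutator mu a b) = anticommutator mu (alpha a) (alpha b).
  by rewrite /anticommutator linearD !alphaM.
have cubic : mu (anticommutator mu (alpha x) (alpha x)) (mu (alpha x) (alpha y))
    = mu (alpha (alpha x)) (mu (anticommutator mu x x) (alpha y)).
  apply: (scalerI K3); rewrite !scaler_nat !mulrSr !mulr0n !add0r.
  exact: (pre1 x x x y).
have := pre2 x y x x; rewrite -(pre1 x y x x) -addrA => quartic.
rewrite /hom_associator /= alpha_circ.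
rewrite [X in X - _]/anticommutator [X in _ - X]/anticommutator.
set c := anticommutator mu (anticommutator mu x x) (alpha y).
have -> : mu (alpha (alpha x)) c
    = mu (alpha (alpha x)) (mu (anticommutator mu x x) (alpha y))
      + (mu (alpha (alpha x)) (mu (alpha y) (mu x x))
         + mu (alpha (alpha x)) (mu (alpha y) (mu x x))).
  by rewrite /c /anticommutator !(linearDr, linearDl).
rewrite -cubic addrCA quartic.
rewrite [anticommutator mu (alpha y) (alpha x)]circC.
set xx := anticommutator mu (alpha x) (alpha x).
rewrite {3}/anticommutator.
have -> : mu (anticommutator mu (alpha x) (alpha y)) xx
    = mu (anticommutator mu (alpha x) (alpha y)) (mu (alpha x) (alpha x))
      + mu (anticommutator mu (alpha x) (alpha y)) (mu (alpha x) (alpha x)).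
  by rewrite {1}/xx {1}/anticommutator linearDr.
rewrite linearDr.
apply/eqP; rewrite subr_eq0; apply/eqP.
by rewrite addrA addrAC.
Qed.

(** * Hom-algebra structures along a surjective linear map *)

Lemma hom_pre_Jordan_surj (K : fieldType) (A B : lmodType K)
    (mu : {bilinear A -> A -> A}) (alpha : {linear A -> A})
    (nu : {bilinear B -> B -> B}) (beta : {linear B -> B})
    (f : {linear A -> B}) :
  (forall b, exists a, f a = b) -> hom_morphism mu alpha nu beta f ->
  hom_pre_Jordan mu alpha -> hom_pre_Jordan nu beta.
Proof.
move=> f_surj [fM f_alpha] [pre1 pre2].
have f_circ u v :
    f (anticommutator mu u v) = anticommutator nu (f u) (f v).
  by rewrite /anticommutator linearD !fM.
split=> a b c d;
  have [[[[x <-] [y <-]] [z <-]] [u <-]] :=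
    (f_surj a, f_surj b, f_surj c, f_surj d).
- have := congr1 f (pre1 x y z u).
  by rewrite !linearD !(fM, f_circ, f_alpha).
- have := congr1 f (pre2 x y z u).
  by rewrite !linearD !(fM, f_circ, f_alpha).
Qed.

Section Descent.
Variables (K : fieldType) (V W : lmodType K) (f : {linear V -> W}).
Hypothesis f_surj : forall w, exists v, f v = w.

Lemma surj_section : exists s : W -> V, cancel s f.
Proof. by have [s sK] := choice f_surj; exists s. Qed.

(** A section of [f] need not be linear, but since [g] preserves the kernel, the
    value [f (g v)] depends on [f v] only; this independence of the chosen
    preimage is also what makes the induced map linear. *)
Lemma linear_descent (g : {linear V -> V}) :
  (forall v, f v = 0 -> f (g v) = 0) ->
  exists h : {linear W -> W}, forall v, h (f v) = f (g v).
Proof.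
move=> kerg; have [s sK] := surj_section.
have sE v : f (g (s (f v))) = f (g v).
  by apply/eqP; rewrite -subr_eq0 -!linearB kerg ?linearB /= ?sK ?subrr.
pose h w := f (g (s w)).
have hL : linear h.
  move=> a w w'; rewrite /h -{1}(sK w) -{1}(sK w') -linearP sE.
  by rewrite !linearP.
pose hlin := GRing.isLinear.Build K W W *:%R h hL.
pose H : {linear W -> W} := HB.pack h hlin.
by exists H => v; exact: sE.
Qed.

Lemma bilinear_descent (mu : {bilinear V -> V -> V}) :
  (forall u v, f u = 0 -> f (mu u v) = 0) ->
  (forall u v, f v = 0 -> f (mu u v) = 0) ->
  exists nu : {bilinear W -> W -> W}, forall u v, nu (f u) (f v) = f (mu u v).
Proof.
move=> kerl kerr; have [s sK] := surj_section.
have sEl u v : f (mu (s (f u)) v) = f (mu u v).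
  by apply/eqP; rewrite -subr_eq0 -linearB -linearBl kerl ?linearB /= ?sK ?subrr.
have sEr u v : f (mu u (s (f v))) = f (mu u v).
  by apply/eqP; rewrite -subr_eq0 -linearB -linearBr kerr ?linearB /= ?sK ?subrr.
pose nu w w' := f (mu (s w) (s w')).
have nuL : bilinear_for *:%R *:%R nu.
  split=> w a x y; rewrite /nu -{1}(sK x) -{1}(sK y) -linearP ?sEl ?sEr.
    by rewrite linearPl linearP.
  by rewrite linearPr linearP.
pose nub := bilinear_isBilinear.Build K W W W *:%R *:%R nu nuL.
pose H : {bilinear W -> W -> W} := HB.pack nu nub.
by exists H => u v; rewrite /H /= /nu sEl sEr.
Qed.

End Descent.

(** * The product of an O-operator *)

Section OOperator.
Variables (K : fieldType) (A V : lmodType K).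
Variables (mu : {bilinear A -> A -> A}) (alpha : {linear A -> A}).
Variables (rho : {bilinear A -> V -> V}) (phi : {linear V -> V}).
Variable T : {linear V -> A}.
Hypothesis hT : O_operator mu alpha rho phi T.

Lemma O_operator_morphism :
  hom_morphism (anticommutator (O_product rho T)) phi mu alpha T.
Proof. by case: hT => Tphi TM; split=> // u v; rewrite TM. Qed.

Lemma O_product_morph :
  hom_Jordan_representation mu alpha rho phi ->
  {morph phi : u v / O_product rho T u v}.
Proof.
by case: hT => Tphi _ [rho_phi _ _] u v; rewrite /O_product rho_phi Tphi.
Qed.

Lemma O_product_hom_pre_Jordan :
  (forall x y, mu x y = mu y x) ->
  hom_Jordan_representation mu alpha rho phi ->
  hom_pre_Jordan (O_product rho T) phi.
Proof.
move=> muC [_ rep1 rep2].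
have [/= Tcirc Tphi] := O_operator_morphism.
have OE u v : O_product rho T u v = rho (T u) v by [].
split=> x y z u; rewrite /= !OE !(Tcirc, Tphi); first exact: esym (rep1 _ _ _ _).
(* The second axiom is the third representation identity at (x, z, y), in which
   the three summands on the right come in another order. *)
rewrite rep1 rep2 (muC (alpha (T x)) (alpha (T z))).
rewrite (muC (alpha (T z)) (alpha (T y))) (muC (alpha (T y)) (alpha (T x))).
by rewrite [LHS]addrC [X in _ + X = _]addrC addrA.
Qed.

Lemma O_product_kerl u v : T u = 0 -> T (O_product rho T u v) = 0.
Proof. by rewrite /O_product => ->; rewrite linear0l linear0. Qed.

(** Since [T v = 0] kills [rho (T v) u], the other term of the O-operator
    equation is alone equal to [mu (T u) 0]. *)
Lemma O_product_kerr u v : T v = 0 -> T (O_product rho T u v) = 0.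
Proof.
case: hT => _ TM Tv0; have := TM u v.
by rewrite Tv0 linear0r linear0l addr0.
Qed.

Lemma range_hom_subalgebra : hom_subalgebra mu alpha (range T).
Proof.
case: hT => Tphi TM; split; first exact: range_submod_closed.
- by move=> _ _ [u _ <-] [v _ <-]; rewrite TM; eexists.
- by move=> _ [u _ <-]; exists (phi u).
Qed.

End OOperator.

Lemma to_image_surj (K : fieldType) (A V : lmodType K) (T : {linear V -> A})
  (a : linear_image T) : exists v, to_image T v = a.
Proof.
have /set_mem[v _ Tv] := valP a.
by exists v; apply: val_inj; rewrite SubK.
Qed.

Lemma to_image_eq0 (K : fieldType) (A V : lmodType K) (T : {linear V -> A})
  (v : V) : to_image T v = 0 <-> T v = 0.
Proof.
split=> [/(congr1 val)|Tv0]; first by rewrite SubK linear0.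
by apply: val_inj; rewrite SubK linear0.
Qed.

Theorem proposition2p3 (K : fieldType) (charK0 : [pchar K] =i pred0)
    (A V : lmodType K)
    (mu : {bilinear A -> A -> A}) (alpha : {linear A -> A})
    (hA : hom_Jordan mu alpha)
    (rho : {bilinear A -> V -> V}) (phi : {linear V -> V})
    (hV : hom_Jordan_representation mu alpha rho phi)
    (T : {linear V -> A}) (hT : O_operator mu alpha rho phi T) :
  (* 1 *)
  hom_pre_Jordan (O_product rho T) phi /\
  (* 2 *)
  (hom_Jordan (anticommutator (O_product rho T)) phi /\
   hom_morphism (anticommutator (O_product rho T)) phi mu alpha T) /\
  (* 3 and 4; beta is the restriction of alpha to T(V), and the inclusion val
     being a morphism says that the associated product is the restriction of mu *)
  hom_subalgebra mu alpha (range T) /\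
  exists beta : {linear linear_image T -> linear_image T},
    (forall a, val (beta a) = alpha (val a)) /\
    exists dot : {bilinear linear_image T -> linear_image T -> linear_image T},
      (forall u v,
         dot (to_image T u) (to_image T v) = to_image T (O_product rho T u v)) /\
      hom_pre_Jordan dot beta /\
      (hom_Jordan (anticommutator dot) beta /\
       hom_morphism (anticommutator dot) beta mu alpha
         (val : {linear linear_image T -> A})) /\
      hom_morphism (O_product rho T) phi dot beta
        (to_image T).
Proof.
have K3 : 3%:R != 0 :> K by have := charK0 3; rewrite !inE /= => ->.
have muC := hA.1.
have preV := O_product_hom_pre_Jordan hT muC hV.
have phiM := O_product_morph hT hV.
have Tmorph := O_operator_morphism hT.
have [Tcirc Tphi] := Tmorph.
split=> //; split; first by split=> //; exact: hom_Jordan_anticommutator.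
split; first exact: range_hom_subalgebra hT.
have surj := @to_image_surj K A V T.
have [beta betaE] : exists beta : {linear linear_image T -> linear_image T},
    forall v, beta (to_image T v) = to_image T (phi v).
  apply: (linear_descent surj) => v /to_image_eq0 Tv0.
  by apply/to_image_eq0; rewrite Tphi Tv0 linear0.
have [dot dotE] :
    exists dot : {bilinear linear_image T -> linear_image T -> linear_image T},
    forall u v,
      dot (to_image T u) (to_image T v) = to_image T (O_product rho T u v).
  apply: (bilinear_descent surj) => u v /to_image_eq0 T0; apply/to_image_eq0.
    exact: O_product_kerl.
  exact: (O_product_kerr hT).
have imM : hom_morphism (O_product rho T) phi dot beta (to_image T).
  by split=> *; rewrite ?dotE ?betaE.
have val_beta a : val (beta a) = alpha (val a).
  by have [v <-] := surj a; rewrite betaE !SubK Tphi.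
have preI := hom_pre_Jordan_surj surj imM preV.
have betaM : {morph beta : a b / dot a b}.
  move=> a b; have [[u <-] [v <-]] := (surj a, surj b).
  by rewrite dotE !betaE phiM dotE.
exists beta; split=> //; exists dot; split=> //; split=> //; split=> //.
split; first exact: hom_Jordan_anticommutator.
split=> // a b; have [[u <-] [v <-]] := (surj a, surj b).
by rewrite /= /anticommutator !dotE -[RHS]Tcirc linearD.
Qed.
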